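(* Let $(V,\mathcal{Y},c)$ be a vertex coalgebra and let $D^*:V\to V$ be the linear map defined by $$D^*=\mathrm{Res}_x\, x^{-2}(Id_V\otimes c)\mathcal{Y}(x).$$ Then $$(D^*\otimes Id_V)\mathcal{Y}(x)=\frac{d}{dx}\mathcal{Y}(x).$$
   Context: All vector spaces are over a field $\mathbb{F}$ of characteristic $0$, and $x,x_0,x_1,x_2$ are commuting formal variables. $\delta(x)=\sum_{n\in\mathbb{Z}}x^n$. For $n\in\mathbb{Z}$, $(x_i\pm x_j)^n$ is expanded in nonnegative integral powers of the second listed variable $x_j$ (this also applies inside $\delta$). $\mathrm{Res}_x$ denotes the coefficient of $x^{-1}$. For a vector space $W$, $W[[x,x^{-1}]]$ is the space of all doubly infinite formal series, and $W((x^{-1}))$ is the space of formal series with only finitely many positive powers of $x$. $T:V\otimes V\to V\otimes V$ is the transposition $T(u\otimes v)=v\otimes u$. Linear maps act on formal series coefficientwise. A vertex coalgebra $(V,\mathcal{Y},c)$ is a vector space $V$ with linear maps $\mathcal{Y}(x):V\to(V\otimes V)[[x,x^{-1}]]$ (coproduct) and $c:V\to\mathbb{F}$ (covacuum map) such that for all $v\in V$: 1. Left counit: $(c\otimes Id_V)\mathcal{Y}(x)v=v$. 2. Cocreation: $(Id_V\otimes c)\mathcal{Y}(x)v\in V[[x]]$ and $\lim_{x\to0}(Id_V\otimes c)\mathcal{Y}(x)v=v$. 3. Truncation: $\mathcal{Y}(x)v\in(V\otimes V)((x^{-1}))$. 4. Jacobi identity: $$x_0^{-1}\delta\left(\tfrac{x_1-x_2}{x_0}\right)(Id_V\otimes\mathcal{Y}(x_2))\mathcal{Y}(x_1)-x_0^{-1}\delta\left(\tfrac{x_2-x_1}{-x_0}\right)(T\otimes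 Id_V)(Id_V\otimes\mathcal{Y}(x_1))\mathcal{Y}(x_2)=x_2^{-1}\delta\left(\tfrac{x_1-x_0}{x_2}\right)(\mathcal{Y}(x_0)\otimes Id_V)\mathcal{Y}(x_2).$$ *)

(* Defs.v *)
From HB Require Import structures.
From mathcomp Require Import all_boot all_algebra.
From mathcomp Require Import finmap.
From mathcomp.multinomials Require Import monalg.
From mathcomp Require Import boolp classical_sets fsbigop.

Set Implicit Arguments.
Unset Strict Implicit.
Unset Printing Implicit Defensive.

Import GRing.Theory.
Local Open Scope ring_scope.
Local Open Scope quotient_scope.

(* The tensor product of two vector spaces U and W: the free vector space on
   the set U * W modulo the subspace spanned by the bilinearity relations. *)
Section Tensor.
Variables (F : fieldType) (U W : lmodType F).

Local Notation free := {malg F[(U * W)%type]}.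

Definition fgen (u : U) (w : W) : free := mkmalgU (u, w) 1.

Inductive bilin_rel : free -> Prop :=
| Bilin0 : bilin_rel 0
| BilinP a x y : bilin_rel x -> bilin_rel y -> bilin_rel (a *: x + y)
| BilinL a u u' w :
    bilin_rel (fgen (a *: u + u') w - (a *: fgen u w + fgen u' w))
| BilinR a u w w' :
    bilin_rel (fgen u (a *: w + w') - (a *: fgen u w + fgen u w')).

Definition bilin_relb : {pred free} := fun x => `[< bilin_rel x >].

Fact bilin_relZ a x : x \in bilin_relb -> a *: x \in bilin_relb.
Proof.
move=> /asboolP xR; apply/asboolP.
by rewrite -[_ *: x]addr0; apply: BilinP => //; apply: Bilin0.
Qed.

Fact bilin_relb_zmod : zmod_closed bilin_relb.
Proof.
split=> [|x y xR yR]; first by apply/asboolP; apply: Bilin0.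
have /asboolP yR' := yR; have /asboolP xR' := xR.
by apply/asboolP; rewrite addrC -scaleN1r; apply: BilinP.
Qed.

HB.instance Definition _ :=
  GRing.isZmodClosed.Build free bilin_relb bilin_relb_zmod.

Definition tensor : Type := Quotient.quot bilin_relb.

HB.instance Definition _ := Choice.on tensor.
HB.instance Definition _ := GRing.Zmodule.on tensor.

Definition tpi (x : free) : tensor := \pi_(Quotient.quot bilin_relb) x.
Definition trepr (t : tensor) : free :=
  @repr _ (Quotient.quot bilin_relb) t.

Lemma treprK : cancel trepr tpi. Proof. exact: reprK. Qed.

Lemma tpiB : {morph tpi : x y / x - y}.
Proof. by move=> x y; rewrite /tpi raddfB. Qed.

Lemma tpiD : {morph tpi : x y / x + y}.
Proof. by move=> x y; rewrite /tpi raddfD. Qed.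

Lemma tpi_eq x y : reflect (tpi x = tpi y) (x - y \in bilin_relb).
Proof. by rewrite Quotient.idealrBE; apply: eqP. Qed.

End Tensor.

(* The operations below are sealed to keep unification from unfolding the
   quotient; they are characterized by tpiZ, tensor_liftE and tensor_ext. *)
HB.lock Definition tscale (F : fieldType) (U W : lmodType F) (a : F)
  (t : tensor U W) : tensor U W := tpi (a *: trepr t).

HB.lock Definition tens (F : fieldType) (U W : lmodType F) (u : U) (w : W) :
  tensor U W := tpi (fgen u w).

Section TensorLmodule.
Variables (F : fieldType) (U W : lmodType F).

Local Notation free := {malg F[(U * W)%type]}.
Local Notation tensor := (tensor U W).
Local Notation tscale := (@tscale F U W).
Local Notation tens := (@tens F U W).
Local Notation tpi := (@tpi F U W).

Lemma tpiZ a x : tpi (a *: x) = tscale a (tpi x).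
Proof.
rewrite tscale.unlock.
by apply/tpi_eq; rewrite -scalerBr; apply/bilin_relZ/tpi_eq; rewrite treprK.
Qed.

Fact tscaleA a b t : tscale a (tscale b t) = tscale (a * b) t.
Proof. by rewrite -[t]treprK -!tpiZ scalerA. Qed.

Fact tscale1 : left_id 1 tscale.
Proof. by move=> t; rewrite -[t]treprK -tpiZ scale1r. Qed.

Fact tscaleDr : right_distributive tscale +%R.
Proof.
by move=> a s t; rewrite -[s]treprK -[t]treprK -tpiD -!tpiZ scalerDr tpiD.
Qed.

Fact tscaleDl t : {morph tscale^~ t : a b / a + b}.
Proof. by move=> a b; rewrite -[t]treprK -!tpiZ scalerDl tpiD. Qed.

HB.instance Definition _ := GRing.Zmodule_isLmodule.Build F tensor
  tscaleA tscale1 tscaleDr tscaleDl.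

Fact tpi_is_linear : linear tpi.
Proof. by move=> a x y; rewrite tpiD tpiZ. Qed.

Fact tpi_linearZ a x : tpi (a *: x) = a *: tpi x. Proof. exact: tpiZ. Qed.

HB.instance Definition _ := GRing.isLinear.Build F free tensor _ tpi
  tpi_is_linear.

Fact tens_is_bilinear : bilinear_for *:%R *:%R tens.
Proof.
by split=> [w a u u' | u a w w']; rewrite /= tens.unlock -tpi_is_linear;
  apply/tpi_eq/asboolP; [apply: BilinL | apply: BilinR].
Qed.

HB.instance Definition _ := bilinear_isBilinear.Build F U W tensor _ _ tens
  tens_is_bilinear.

Lemma tensPl a u u' w : tens (a *: u + u') w = a *: tens u w + tens u' w.
Proof. exact: (tens_is_bilinear.1 w). Qed.

Lemma tensPr a u w w' : tens u (a *: w + w') = a *: tens u w + tens u w'.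
Proof. exact: (tens_is_bilinear.2 u). Qed.

Lemma tensZl a u w : tens (a *: u) w = a *: tens u w.
Proof. exact: (scalable_linear (tens_is_bilinear.1 w)). Qed.

Lemma tensZr a u w : tens u (a *: w) = a *: tens u w.
Proof. exact: (scalable_linear (tens_is_bilinear.2 u)). Qed.

Lemma tensor_span (t : tensor) :
  exists s : seq (U * W), t = \sum_(p <- s) tens p.1 p.2.
Proof.
exists [seq (((trepr t)@_k)%R *: k.1, k.2) | k <- enum_fset (msupp (trepr t))].
rewrite big_map -[LHS]treprK {1}[trepr t]monalgE raddf_sum; apply: eq_bigr.
move=> [u w] _ /=; rewrite tensZl tens.unlock -tpi_linearZ; congr tpi.
by apply/malgP=> k; rewrite mcoeffZ !mcoeffU mulr_natr.
Qed.

End TensorLmodule.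

Section FreeLift.
Variables (F : fieldType) (U W Z : lmodType F) (f : {bilinear U -> W -> Z}).

Local Notation free := {malg F[(U * W)%type]}.

Definition free_lift (x : free) : Z :=
  \sum_(k <- msupp x) x@_k *: f k.1 k.2.

Lemma free_liftEw (d : {fset (U * W)%type}) x : (msupp x `<=` d)%fset ->
  free_lift x = \sum_(k <- d) x@_k *: f k.1 k.2.
Proof.
move=> le; rewrite /free_lift (big_fset_incl _ le) //.
by move=> k _ /mcoeff_outdom ->; rewrite scale0r.
Qed.

Fact free_lift_is_linear : linear free_lift.
Proof.
move=> a x y; pose d := (msupp x `|` msupp y `|` msupp (a *: x + y))%fset.
rewrite !(@free_liftEw d); first last.
- exact: fsubsetUr.
- by apply: fsubset_trans (fsubsetUl _ _); apply: fsubsetUl.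
- by apply: fsubset_trans (fsubsetUl _ _); apply: fsubsetUr.
rewrite scaler_sumr -big_split; apply: eq_bigr => k _ /=.
by rewrite mcoeffD mcoeffZ scalerDl scalerA.
Qed.

HB.instance Definition _ := GRing.isLinear.Build F free Z _ free_lift
  free_lift_is_linear.

Lemma free_lift_gen u w : free_lift (fgen u w) = f u w.
Proof.
rewrite (@free_liftEw [fset (u, w)]%fset) ?msuppU_le //.
by rewrite big_seq_fset1 mcoeffUU scale1r.
Qed.

Lemma free_lift_rel x : bilin_rel x -> free_lift x = 0.
Proof.
elim=> [|a y z _ y0 _ z0|a u u' w|a u w w'].
- by rewrite linear0.
- by rewrite free_lift_is_linear y0 z0 scaler0 addr0.
- by rewrite linearB /= free_lift_is_linear !free_lift_gen linearPl subrr.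
- by rewrite linearB /= free_lift_is_linear !free_lift_gen linearPr subrr.
Qed.

End FreeLift.

(* The linear map on U (x) W induced by a bilinear map f. *)
HB.lock Definition tensor_lift (F : fieldType) (U W Z : lmodType F)
  (f : {bilinear U -> W -> Z}) (t : tensor U W) : Z := free_lift f (trepr t).

Section Lift.
Variables (F : fieldType) (U W Z : lmodType F) (f : {bilinear U -> W -> Z}).

Local Notation tensor_lift := (tensor_lift f).
Local Notation tensor := (tensor U W).

Lemma tensor_lift_pi x : tensor_lift (tpi x) = free_lift f x.
Proof.
rewrite tensor_lift.unlock.
apply/eqP; rewrite -subr_eq0 -linearB; apply/eqP/free_lift_rel/asboolP.
by apply/tpi_eq; rewrite treprK.
Qed.

Fact tensor_lift_is_linear : linear tensor_lift.
Proof.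
move=> a s t; rewrite -[s]treprK -[t]treprK -tpi_is_linear !tensor_lift_pi.
exact: linearP.
Qed.

HB.instance Definition _ := GRing.isLinear.Build F tensor Z _ tensor_lift
  tensor_lift_is_linear.

Lemma tensor_liftE u w : tensor_lift (tens u w) = f u w.
Proof. by rewrite tens.unlock tensor_lift_pi free_lift_gen. Qed.

End Lift.

Lemma tensor_ext (F : fieldType) (U W Z : lmodType F) (f g : {linear tensor U W -> Z}) :
  (forall u w, f (tens u w) = g (tens u w)) -> f =1 g.
Proof.
move=> fg t; have [s ->] := tensor_span t.
by rewrite !linear_sum; apply: eq_bigr => p _; apply: fg.
Qed.

Section TensorMaps.
Variable F : fieldType.

Section Map.
Variables (U U' W W' : lmodType F).
Variables (f : {linear U -> U'}) (g : {linear W -> W'}).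

Definition tens_of (u : U) (w : W) : tensor U' W' := tens (f u) (g w).

Fact tens_of_bilinear : bilinear_for *:%R *:%R tens_of.
Proof.
by split=> [w a u u' | u a w w']; rewrite /= /tens_of linearP ?tensPl ?tensPr.
Qed.

HB.instance Definition _ := bilinear_isBilinear.Build F U W (tensor U' W') _ _
  tens_of tens_of_bilinear.

(* The linear map f (x) g. *)
Definition tmap : tensor U W -> tensor U' W' := tensor_lift tens_of.

HB.instance Definition _ := GRing.Linear.on tmap.

Lemma tmapE u w : tmap (tens u w) = tens (f u) (g w).
Proof. exact: tensor_liftE. Qed.

End Map.

Section Swap.
Variables U W : lmodType F.

Definition tens_flip (u : U) (w : W) : tensor W U := tens w u.

Fact tens_flip_bilinear : bilinear_for *:%R *:%R tens_flip.
Proof.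
by split=> [w a u u' | u a w w']; rewrite /= /tens_flip ?tensPl ?tensPr.
Qed.

HB.instance Definition _ := bilinear_isBilinear.Build F U W (tensor W U) _ _
  tens_flip tens_flip_bilinear.

Definition tswap : tensor U W -> tensor W U := tensor_lift tens_flip.

HB.instance Definition _ := GRing.Linear.on tswap.

Lemma tswapE u w : tswap (tens u w) = tens w u.
Proof. exact: tensor_liftE. Qed.

End Swap.

Section Assoc.
Variables U V W : lmodType F.

Section AssocL.
Variable u : U.

Definition tens_assoc1 (v : V) (w : W) : tensor (tensor U V) W :=
  tens (tens u v) w.

Fact tens_assoc1_bilinear : bilinear_for *:%R *:%R tens_assoc1.
Proof.
by split=> [w a v v' | v a w w']; rewrite /= /tens_assoc1 tensPr ?tensPl.
Qed.

HB.instance Definition _ := bilinear_isBilinear.Build F V W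
  (tensor (tensor U V) W) _ _ tens_assoc1 tens_assoc1_bilinear.

End AssocL.

Definition tens_assoc (u : U) (t : tensor V W) : tensor (tensor U V) W :=
  tensor_lift (tens_assoc1 u) t.

Fact tens_assoc_bilinear : bilinear_for *:%R *:%R tens_assoc.
Proof.
split=> [t a u u' | u a t t'] /=; last exact: linearP.
have [s ->] := tensor_span t; rewrite /tens_assoc !linear_sum.
rewrite -big_split; apply: eq_bigr => p _ /=.
by rewrite !tensor_liftE /= /tens_assoc1 !tensPl.
Qed.

HB.instance Definition _ := bilinear_isBilinear.Build F U (tensor V W)
  (tensor (tensor U V) W) _ _ tens_assoc tens_assoc_bilinear.

Definition tassoc : tensor U (tensor V W) -> tensor (tensor U V) W :=
  tensor_lift tens_assoc.

HB.instance Definition _ := GRing.Linear.on tassoc.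

Lemma tassocE u v w : tassoc (tens u (tens v w)) = tens (tens u v) w.
Proof. by rewrite [LHS]tensor_liftE [LHS]tensor_liftE. Qed.

End Assoc.

Section Unit.
Variable V : lmodType F.

Definition scale_l (a : F^o) (v : V) : V := a *: v.
Definition scale_r (v : V) (a : F^o) : V := a *: v.

Fact scale_l_bilinear : bilinear_for *:%R *:%R scale_l.
Proof.
split=> [v a b b' | b a v v']; rewrite /= /scale_l.
  by rewrite scalerDl scalerA.
by rewrite scalerDr !scalerA mulrC.
Qed.

Fact scale_r_bilinear : bilinear_for *:%R *:%R scale_r.
Proof. by split=> [b a v v' | v a b b']; apply scale_l_bilinear. Qed.

HB.instance Definition _ := bilinear_isBilinear.Build F F^o V V _ _
  scale_l scale_l_bilinear.
HB.instance Definition _ := bilinear_isBilinear.Build F V F^o V _ _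
  scale_r scale_r_bilinear.

(* The canonical isomorphisms F (x) V = V and V (x) F = V. *)
Definition tunit_l : tensor F^o V -> V := tensor_lift scale_l.
Definition tunit_r : tensor V F^o -> V := tensor_lift scale_r.

HB.instance Definition _ := GRing.Linear.on tunit_l.
HB.instance Definition _ := GRing.Linear.on tunit_r.

Lemma tunit_lE a v : tunit_l (tens a v) = a *: v.
Proof. exact: tensor_liftE. Qed.

Lemma tunit_rE v a : tunit_r (tens v a) = a *: v.
Proof. exact: tensor_liftE. Qed.

End Unit.

End TensorMaps.

Section FormalSeries.
Variables (F : fieldType) (W : lmodType F).

(* W[[x,x^-1]]: s n is the coefficient of x^n. *)
Definition series := int -> W.

(* x^k s(x) *)
Definition xmul (k : int) (s : series) : series := fun n => s (n - k).

Definition Res (s : series) : W := s (-1).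

Definition dx (s : series) : series := fun n => (n + 1)%:~R *: s (n + 1).

(* W[[x0,x0^-1,x1,x1^-1,x2,x2^-1]]: s (i, j, k) is the coefficient of
   x0^i x1^j x2^k. *)
Definition series3 := int * int * int -> W.

(* The product of a scalar series and a series, both in x0, x1, x2. It exists
   when the sum below has finitely many nonzero terms for every e; the big
   operator returns 0 otherwise. In the Jacobi identity, truncation makes all
   these sums finite. *)
Definition mul3 (d : int * int * int -> F) (s : series3) : series3 :=
  fun e => \sum_(p \in [set: int * int * int]) d p *: s (e - p).

End FormalSeries.

Section Delta.
Variable F : fieldType.

(* n (n - 1) ... (n - k + 1) / k!, for n of any sign *)
Definition binz (n : int) (k : nat) : F :=
  (\prod_(i < k) (n%:~R - i%:R)) / (k`!)%:R.

(* The coefficient of y^p z^q in (y - z)^n, expanded in nonnegative powers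
   of z. *)
Definition subX (n p q : int) : F :=
  match q with
  | Posz k => if p + k%:Z == n then (-1) ^+ k * binz n k else 0
  | Negz _ => 0
  end.

(* x0^-1 delta((x1 - x2) / x0) = \sum_n x0^(-n-1) (x1 - x2)^n *)
Definition delta12 (e : int * int * int) : F :=
  let: (i, j, k) := e in subX (- i - 1) j k.

(* x0^-1 delta((x2 - x1) / - x0) = \sum_n (-1)^n x0^(-n-1) (x2 - x1)^n *)
Definition delta21 (e : int * int * int) : F :=
  let: (i, j, k) := e in (-1) ^ (- i - 1) * subX (- i - 1) k j.

(* x2^-1 delta((x1 - x0) / x2) = \sum_n x2^(-n-1) (x1 - x0)^n *)
Definition delta10 (e : int * int * int) : F :=
  let: (i, j, k) := e in subX (- k - 1) j i.

End Delta.

Section VertexCoalgebra.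
Variables (F : fieldType) (V : lmodType F).

(* A linear map V -> (V (x) V)[[x,x^-1]] is given by its coefficients: Y n is
   the coefficient of x^n. *)
Variables (Y : int -> {linear V -> tensor V V}) (c : {linear V -> F^o}).

Definition coprod (v : V) : series (tensor V V) := fun n => Y n v.

(* (c (x) Id) Y(x) v and (Id (x) c) Y(x) v *)
Definition counit_l (v : V) : series V :=
  fun n => tunit_l (tmap c idfun (coprod v n)).
Definition counit_r (v : V) : series V :=
  fun n => tunit_r (tmap idfun c (coprod v n)).

(* The iterated coproducts of the Jacobi identity, in (V (x) V) (x) V:
   (Id (x) Y(x2)) Y(x1) v, (T (x) Id) (Id (x) Y(x1)) Y(x2) v and
   (Y(x0) (x) Id) Y(x2) v *)
Definition iter12 (v : V) : series3 (tensor (tensor V V) V) :=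
  fun e => let: (i, j, k) := e in
    if i == 0 then tassoc (tmap idfun (Y k) (coprod v j)) else 0.
Definition iter21 (v : V) : series3 (tensor (tensor V V) V) :=
  fun e => let: (i, j, k) := e in
    if i == 0 then
      tmap (@tswap F V V) idfun (tassoc (tmap idfun (Y j) (coprod v k)))
    else 0.
Definition iter02 (v : V) : series3 (tensor (tensor V V) V) :=
  fun e => let: (i, j, k) := e in
    if j == 0 then tmap (Y i) idfun (coprod v k) else 0.

Record vertex_coalgebra : Prop := VertexCoalgebra {
  left_counit : forall v n, counit_l v n = if n == 0 then v else 0;
  cocreation : forall v,
    (forall n, n < 0 -> counit_r v n = 0) /\ counit_r v 0 = v;
  truncation : forall v, exists N : int, forall n, N < n -> coprod v n = 0;
  jacobi : forall v e,
    mul3 (@delta12 F) (iter12 v) e - mul3 (@delta21 F) (iter21 v) e =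
    mul3 (@delta10 F) (iter02 v) e
}.

(* D^* = Res_x x^-2 (Id (x) c) Y(x) *)
Definition Dstar (v : V) : V := Res (xmul (-2) (counit_r v)).

Fact Dstar_is_linear : linear Dstar.
Proof.
by move=> a u v; rewrite /Dstar /Res /xmul /counit_r /coprod !linearP.
Qed.

HB.instance Definition _ := GRing.isLinear.Build F V V _ Dstar Dstar_is_linear.

End VertexCoalgebra.

(* Main.v *)
From HB Require Import structures.
Require Import Defs.
From mathcomp Require Import all_boot all_algebra.
From mathcomp Require Import boolp classical_sets fsbigop.
From mathcomp Require Import zify.

Set Implicit Arguments.
Unset Strict Implicit.
Unset Printing Implicit Defensive.

Import GRing.Theory.
Local Open Scope ring_scope.

(** Applying [Id (x) c (x) Id] to the Jacobi identity turns the three iterated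
    coproducts into series with a single factor [Y]:
    - the left counit makes [(Id (x) Y(x2)) Y(x1)] and the transposed
      [(Id (x) Y(x1)) Y(x2)] both contract to [Y(x1)], free of [x2];
    - [(Y(x0) (x) Id) Y(x2)] contracts to [(E(x0) (x) Id) Y(x2)], where
      [E(x0) = (Id (x) c) Y(x0) = Id + x0 D^* + ...] by cocreation.

    Now compare the coefficients of [x0 x2^-1]. On the left nothing remains:
    the coefficient of [x0] in [x0^-1 delta((x1 - x2) / x0)] is
    [(x1 - x2)^-2], which has only nonnegative powers of [x2], and in
    [x0^-1 delta((x2 - x1) / - x0)] it is [(x2 - x1)^-2], which has only powers
    of [x2] below [-1] ([delta12_contract_eq0], [delta21_contract_eq0]).
    On the right, as [E] has no negative power, only the first two terms
    of the expansions of [(x1 - x0)^m] contribute; at [x1^n] they are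
    [(D^* (x) Id) Y_n - (n + 1) Y_(n + 1)] ([delta10_contractE]), which is the
    coefficient of [x^n] in [(D^* (x) Id) Y(x) - d/dx Y(x)].

    Contracting term by term is legitimate because truncation makes
    the sums defining the coefficients of the Jacobi identity finite
    ([contract_jacobi]). *)

(** * Coefficients of products with delta functions *)

Lemma fsum_seq (W : nmodType) (T : choiceType) (f : T -> W) (r : seq T) :
  (forall p, p \notin r -> f p = 0) ->
  \sum_(p \in [set: T]) f p = \sum_(p <- undup r) f p.
Proof.
move=> f0; rewrite [RHS]bigfs ?undup_uniq //.
  by apply: eq_fsbigl; apply/seteqP; split.
by move=> p _; rewrite mem_undup; apply: f0.
Qed.

Lemma mul3_eq0 (F : fieldType) (W : lmodType F) (d : int * int * int -> F)
    (s : series3 W) e :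
  (forall p, d p != 0 -> s (e - p) = 0) -> mul3 d s e = 0.
Proof.
move=> ds0; apply: fsbig1 => p _.
by have [->|/ds0 ->] := eqVneq (d p) 0; rewrite ?scale0r ?scaler0.
Qed.

(** Finiteness is essential: a sum of infinitely many nonzero terms is [0] by
    convention, and could become a genuine finite sum once [L] kills almost
    all of its terms. *)
Lemma linear_mul3 (F : fieldType) (W W' : lmodType F) (L : {linear W -> W'})
    (d : int * int * int -> F) (s : series3 W) e (r : seq (int * int * int)) :
  (forall p, p \notin r -> d p *: s (e - p) = 0) ->
  L (mul3 d s e) = mul3 d (L \o s) e.
Proof.
move=> ds0; rewrite /mul3 !(fsum_seq (r := r)) //.
  by rewrite linear_sum; apply: eq_bigr => p _; rewrite linearZ.
by move=> p /ds0 dsp0; rewrite /= -linearZ dsp0 linear0.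
Qed.

(** Each delta function is supported, once the exponent that the iterated
    coproduct fixes is prescribed, on a half-line of exponents; truncation then
    bounds the parameter of that half-line. *)
Lemma ray_finite (T : eqType) (W : nmodType) (f : T -> W) (g : nat -> T)
    (M : int) :
  (forall p, f p != 0 -> exists2 q : nat, p = g q & q%:Z <= M) ->
  exists r : seq T, forall p, p \notin r -> f p = 0.
Proof.
move=> fg; exists [seq g q | q <- iota 0 `|M|.+1] => p; apply: contraNeq.
move=> /fg[q -> qM]; apply/mapP; exists q; rewrite // mem_iota.
by rewrite add0n ltnS; lia.
Qed.

Lemma subX_supp (F : fieldType) (n p q : int) :
  subX F n p q != 0 -> exists2 k : nat, q = k%:Z & p = n - k%:Z.
Proof.
case: q => [k|k] /=; last by rewrite eqxx.
by case: ifP => [/eqP <- _|]; [exists k; rewrite // addrK | rewrite eqxx].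
Qed.

Lemma binz0 (F : fieldType) (n : int) : binz F n 0 = 1.
Proof. by rewrite /binz big_ord0 divr1. Qed.

Lemma binz1 (F : fieldType) (n : int) : binz F n 1 = n%:~R.
Proof. by rewrite /binz big_ord1 subr0 divr1. Qed.

Lemma delta10E (F : fieldType) (n : int) (q : nat) :
  delta10 F (q%:Z, n, - n - 1 - q%:Z) = (-1) ^+ q * binz F (n + q%:Z) q.
Proof.
have nq : n + q%:Z = - (- n - 1 - q%:Z) - 1 by lia.
by rewrite /= nq eqxx.
Qed.

(** * Tensor products of linear maps *)

Lemma eq_tmap (F : fieldType) (U U' W W' : lmodType F)
    (f f' : {linear U -> U'}) (g g' : {linear W -> W'}) :
  f =1 f' -> g =1 g' -> tmap f g =1 tmap f' g'.
Proof. by move=> ff gg; apply: tensor_ext => u w; rewrite /= !tmapE ff gg. Qed.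

Lemma tmap_id (F : fieldType) (U W : lmodType F) (t : tensor U W) :
  tmap idfun idfun t = t.
Proof.
have [s ->] := tensor_span t; rewrite linear_sum.
by apply: eq_bigr => p _ /=; rewrite tmapE.
Qed.

Lemma tmap0l (F : fieldType) (U U' W W' : lmodType F)
    (f : {linear U -> U'}) (g : {linear W -> W'}) t :
  (forall u, f u = 0) -> tmap f g t = 0.
Proof.
move=> f0; have [s ->] := tensor_span t; rewrite linear_sum big1 // => p _ /=.
by rewrite tmapE f0 linear0l.
Qed.

Lemma tmap0r (F : fieldType) (U U' W W' : lmodType F)
    (f : {linear U -> U'}) (g : {linear W -> W'}) t :
  (forall w, g w = 0) -> tmap f g t = 0.
Proof.
move=> g0; have [s ->] := tensor_span t; rewrite linear_sum big1 // => p _ /=.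
by rewrite tmapE g0 linear0r.
Qed.

(** * Contraction of the middle factor by the covacuum *)

Section Contraction.
Variables (F : fieldType) (V : lmodType F) (c : {linear V -> F^o}).
Implicit Types t : tensor V V.

Definition contract : tensor (tensor V V) V -> tensor V V :=
  tmap (@tunit_r F V \o tmap idfun c) idfun.

HB.instance Definition _ := GRing.Linear.on contract.

Lemma contract_tens u x w :
  contract (tens (tens u x) w) = tens ((c x : F) *: u) w.
Proof. by rewrite [LHS]tmapE /= tmapE tunit_rE. Qed.

(** After reassociation the middle factor is the left factor of [t], so that
    the covacuum acts on [t] as in the left counit axiom. *)
Lemma contract_tassoc u t :
  contract (tassoc (tens u t)) = tens u (tunit_l (tmap c idfun t)).
Proof.
have [s ->] := tensor_span t; rewrite !(linear_sum, linear_sumr).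
apply: eq_bigr => p _ /=.
by rewrite tassocE contract_tens tmapE tunit_lE tensZl tensZr.
Qed.

(** The transposition brings [u] to the middle, hence under the covacuum. *)
Lemma contract_swap u t :
  contract (tmap (@tswap F V V) idfun (tassoc (tens u t))) = (c u : F) *: t.
Proof.
have [s ->] := tensor_span t; rewrite !(linear_sum, linear_sumr).
apply: eq_bigr => -[v w] _ /=.
by rewrite tassocE tmapE /= tswapE contract_tens tensZl.
Qed.

Lemma contract_coassoc (Yk : {linear V -> tensor V V}) t :
  contract (tassoc (tmap idfun Yk t)) =
  tmap idfun (@tunit_l F V \o tmap c idfun \o Yk) t.
Proof.
have [s ->] := tensor_span t; rewrite !linear_sum; apply: eq_bigr => p _ /=.
by rewrite !tmapE contract_tassoc.
Qed.

Lemma contract_coassoc_swap (Yj : {linear V -> tensor V V}) t :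
  contract (tmap (@tswap F V V) idfun (tassoc (tmap idfun Yj t))) =
  Yj (tunit_l (tmap c idfun t)).
Proof.
have [s ->] := tensor_span t; rewrite !linear_sum; apply: eq_bigr => p _ /=.
by rewrite !tmapE contract_swap tunit_lE linearZ.
Qed.

Lemma contract_left (Yi : {linear V -> tensor V V}) t :
  contract (tmap Yi idfun t) =
  tmap (@tunit_r F V \o tmap idfun c \o Yi) idfun t.
Proof.
have [s ->] := tensor_span t; rewrite !linear_sum; apply: eq_bigr => p _ /=.
by rewrite !tmapE [LHS]tmapE.
Qed.

End Contraction.

(** * The contracted Jacobi identity *)

Section Coalgebra.
Variables (F : fieldType) (V : lmodType F).
Variables (Y : int -> {linear V -> tensor V V}) (c : {linear V -> F^o}).
Hypothesis VC : vertex_coalgebra Y c.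

(** By the left counit, the contraction is [Y(x1) v] with no power of [x2]. *)
Lemma contract_iter12 v i j k : k != 0 ->
  contract c (iter12 Y v (i, j, k)) = 0.
Proof.
rewrite /iter12; case: ifP => _ k0; last exact: linear0.
rewrite contract_coassoc tmap0r // => w.
by rewrite [LHS](left_counit VC) (negPf k0).
Qed.

(** The covacuum meets the left factor of the coproduct [Y(x2)] applied first,
    so the left counit again removes [x2]. *)
Lemma contract_iter21 v i j k : k != 0 ->
  contract c (iter21 Y v (i, j, k)) = 0.
Proof.
rewrite /iter21; case: ifP => _ k0; last exact: linear0.
rewrite contract_coassoc_swap [tunit_l _](left_counit VC) (negPf k0).
exact: linear0.
Qed.

Lemma contract_iter02 v i j k : contract c (iter02 Y v (i, j, k)) =
  if j == 0 then tmap (@tunit_r F V \o tmap idfun c \o Y i) idfun (Y k v)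
  else 0.
Proof.
by rewrite /iter02; case: ifP => _; rewrite ?contract_left ?linear0.
Qed.

Lemma iter12_finite v e : exists r : seq (int * int * int), forall p,
  p \notin r -> delta12 F p *: iter12 Y v (e - p) = 0.
Proof.
have [N trN] := truncation VC v; case: e => [[i j] k].
apply: (ray_finite (g := fun q => (i, - i - 1 - q%:Z, q%:Z))
                   (M := N - (j + i + 1))) => -[[a b] d].
rewrite scaler_eq0 negb_or => /andP[/subX_supp[q -> ->]].
rewrite /iter12 /=; case: ifP; last by rewrite eqxx.
rewrite subr_eq0 => /eqP <- Yn0; exists q => //.
apply: contraNT Yn0 => qN; rewrite trN ?linear0 ?linear0 //; lia.
Qed.

Lemma iter21_finite v e : exists r : seq (int * int * int), forall p,
  p \notin r -> delta21 F p *: iter21 Y v (e - p) = 0.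
Proof.
have [N trN] := truncation VC v; case: e => [[i j] k].
apply: (ray_finite (g := fun q => (i, q%:Z, - i - 1 - q%:Z))
                   (M := N - (k + i + 1))) => -[[a b] d].
rewrite scaler_eq0 negb_or mulf_eq0 negb_or.
move=> /andP[/andP[_ /subX_supp[q -> ->]]].
rewrite /iter21 /=; case: ifP; last by rewrite eqxx.
rewrite subr_eq0 => /eqP <- Yn0; exists q => //.
apply: contraNT Yn0 => qN; rewrite trN ?linear0 ?linear0 //; lia.
Qed.

Lemma iter02_finite v e : exists r : seq (int * int * int), forall p,
  p \notin r -> delta10 F p *: iter02 Y v (e - p) = 0.
Proof.
have [N trN] := truncation VC v; case: e => [[i j] k].
apply: (ray_finite (g := fun q => (q%:Z, j, - j - 1 - q%:Z))
                   (M := N - (k + j + 1))) => -[[a b] d].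
rewrite scaler_eq0 negb_or => /andP[/subX_supp[q -> bE]].
rewrite /iter02 /=; case: ifP; last by rewrite eqxx.
rewrite subr_eq0 => /eqP jb Yn0; exists q; first by congr (_, _, _); lia.
apply: contraNT Yn0 => qN; rewrite trN ?linear0 //; lia.
Qed.

Lemma contract_jacobi v e :
  mul3 (@delta12 F) (contract c \o iter12 Y v) e -
  mul3 (@delta21 F) (contract c \o iter21 Y v) e =
  mul3 (@delta10 F) (contract c \o iter02 Y v) e.
Proof.
have [r1 r1P] := iter12_finite v e; have [r2 r2P] := iter21_finite v e.
have [r3 r3P] := iter02_finite v e.
rewrite -(linear_mul3 _ r1P) -(linear_mul3 _ r2P) -(linear_mul3 _ r3P).
by rewrite -linearB (jacobi VC).
Qed.

Lemma delta12_contract_eq0 v n :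
  mul3 (@delta12 F) (contract c \o iter12 Y v) (1, n, -1) = 0.
Proof.
apply: mul3_eq0 => -[[a b] d] /subX_supp[q dE _].
by rewrite [LHS]contract_iter12 //= dE; lia.
Qed.

Lemma delta21_contract_eq0 v n :
  mul3 (@delta21 F) (contract c \o iter21 Y v) (1, n, -1) = 0.
Proof.
apply: mul3_eq0 => -[[a b] d].
rewrite mulf_eq0 negb_or => /andP[_ /subX_supp[q _ dE]].
have [a1|/negPf a1] := eqVneq (1 - a) 0; last by rewrite /= a1 linear0.
by rewrite [LHS]contract_iter21 //= dE; lia.
Qed.

Lemma delta10_contractE v n :
  mul3 (@delta10 F) (contract c \o iter02 Y v) (1, n, -1) =
  tmap (Dstar Y c) idfun (Y n v) - (n + 1)%:~R *: Y (n + 1) v.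
Proof.
(* The exponents of x0^q x1^n x2^(-m-1) for the terms q = 0, 1 of (x1 - x0)^m, where
   m = n + q. The q-th term meets the coefficient of x0^(1 - q) in
   (Id (x) c) Y(x0), which is zero once q > 1. *)
rewrite /mul3 (@fsum_seq _ _ _
  [:: (0%:Z, n, - n - 1 - 0%:Z); (1%:Z, n, - n - 1 - 1%:Z)]); last first.
  move=> [[a b] d]; rewrite !inE !xpair_eqE => nr.
  have [->|/subX_supp[q aE bE]] := eqVneq (delta10 F (a, b, d)) 0.
    by rewrite scale0r.
  rewrite [(_ \o _) _]contract_iter02.
  have [nb|] := ifP; last by rewrite scaler0.
  rewrite tmap0l ?scaler0 // => u; apply: (cocreation VC u).1.
  by move: nr nb => /=; lia.
rewrite undup_id // big_cons big_seq1 !delta10E binz0 binz1.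
rewrite !exprS !expr0 !mulr1 mulN1r scale1r scaleNr.
rewrite ![(_ \o _) _]contract_iter02 [_ - n]subrr eqxx.
congr (_ - _ *: _).
  rewrite [(1, n, -1).2 + _](_ : _ = n); last by rewrite /=; lia.
  exact: eq_tmap.
rewrite [(1, n, -1).2 + _](_ : _ = n + 1); last by rewrite /=; lia.
by rewrite -[RHS]tmap_id; apply: eq_tmap => // u; apply: (cocreation VC u).2.
Qed.

End Coalgebra.

Theorem proposition2p2 (F : fieldType) (V : lmodType F)
    (Y : int -> {linear V -> tensor V V}) (c : {linear V -> F^o}) :
  [pchar F] =i pred0 ->
  vertex_coalgebra Y c ->
  forall v : V,
    (fun n : int => tmap (Dstar Y c) idfun (coprod Y v n)) =1 dx (coprod Y v).
Proof.
(* The coefficient of x0 x1^n x2^-1 of the contracted Jacobi identity. *)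
move=> _ VC v n; apply/eqP; rewrite -subr_eq0 -(delta10_contractE VC).
rewrite -(contract_jacobi VC) delta12_contract_eq0 // delta21_contract_eq0 //.
by rewrite subrr.
Qed.
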